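(* Let $\mu$ be a probability measure on $\mathrm{Homeo}_+(\mathbb{R})$ with finite or countable support having the shiftability property (note that $\hat\mu$ then also has it). Then, possibly after interchanging $\mu$ and $\hat\mu$ and/or conjugating all maps by $x\mapsto -x$, exactly one of the following holds: \begin{enumerate} \item $\phi_+\equiv 1$ and $\hat\phi_-\equiv 1$; \item $\phi_+\equiv 1$ and $\hat\phi_0\equiv 1$; \item $\phi_0\equiv 1$ and $\hat\phi_0\equiv 1$; \item $\phi_0\equiv 0$, the functions $\phi_+$ and $\phi_-$ are not constant, and $\hat\phi_0\equiv 1$. \end{enumerate}
   Context: Setup. Let $\mu$ be a probability measure on the group $\mathrm{Homeo}_+(\mathbb{R})$ of orientation-preserving homeomorphisms of $\mathbb{R}$, supported on a finite or countable set $\{f_1,f_2,\dots\}$ with $p_i=\mu(\{f_i\})>0$, $\sum_i p_i=1$. Let $g_1,g_2,\dots$ be i.i.d. random maps with law $\mu$, and set $F_0=\mathrm{id}$, $F_n=g_n\circ\cdots\circ g_1$ (forward dynamics). The inverse dynamics is the random dynamical system defined by $\hat\mu$, the image of $\mu$ under $f\mapsto f^{-1}$; its random compositions are denoted $\hat F_n$. For $x\in\mathbb{R}$ let $\phi_+(x)=\mathbb{P}(\lim_n F_n(x)=+\infty)$, $\phi_-(x)=\mathbb{P}(\lim_n F_n(x)=-\infty)$, $\phi_0(x)=1-\phi_+(x)-\phi_-(x)$; $\hat\phi_+,\hat\phi_-,\hat\phi_0$ are defined in the same way for $\hat\mu$. The system has the shiftability property if for every $x\in\mathbb{R}$ there exist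 $f,g$ with $\mu(\{f\})>0$, $\mu(\{g\})>0$ and $g(x)<x<f(x)$. *)

(* Defs.v *)
From HB Require Import structures.
From mathcomp Require Import all_boot all_order all_algebra.
From mathcomp Require Import all_classical all_reals all_analysis.
Set Implicit Arguments. Unset Strict Implicit. Unset Printing Implicit Defensive.
Import Order.TTheory GRing.Theory Num.Theory.
Import numFieldNormedType.Exports.
Local Open Scope classical_set_scope.
Local Open Scope ring_scope.

Section Defs.
Variable R : realType.

Definition is_homeo_plus (f finv : R -> R) : Prop :=
  continuous f /\ {homo f : x y / x < y} /\ cancel f finv /\ cancel finv f.

Variables (I : Type) (d : measure_display) (Omega : measurableType d).

(** Random composition: [iterF g X n w x = g (X (n-1) w) (... (g (X 0 w) x))],
    i.e. F_n = g_n o ... o g_1 where g_k is the map with index X (k-1). *)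
Fixpoint iterF (g : I -> R -> R) (X : nat -> Omega -> I) (n : nat)
  (w : Omega) (x : R) : R :=
  match n with
  | 0 => x
  | n'.+1 => g (X n' w) (iterF g X n' w x)
  end.

Variables (P : probability Omega R) (X : nat -> Omega -> I).

Definition phi_plus (g : I -> R -> R) (x : R) : \bar R :=
  P [set w | (fun n => iterF g X n w x) @ \oo --> +oo_R].
Definition phi_minus (g : I -> R -> R) (x : R) : \bar R :=
  P [set w | (fun n => iterF g X n w x) @ \oo --> -oo_R].
Definition phi_zero (g : I -> R -> R) (x : R) : \bar R :=
  (1 - phi_plus g x - phi_minus g x)%E.

Definition conj_minus (g : I -> R -> R) : I -> R -> R :=
  fun i x => - g i (- x).

(** Transformations: [s] = interchange mu and hat mu,
    [c] = conjugate all maps by x |-> -x. *)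
Definition transform (s c : bool) (gh : (I -> R -> R) * (I -> R -> R))
  : (I -> R -> R) * (I -> R -> R) :=
  let gh' := if s then (gh.2, gh.1) else gh in
  if c then (conj_minus gh'.1, conj_minus gh'.2) else gh'.

Definition nonconstant (u : R -> \bar R) : Prop := exists x y, u x <> u y.

(** The four cases of the theorem for a system (g, h): g forward, h inverse. *)
Definition case_holds (k : nat) (gh : (I -> R -> R) * (I -> R -> R)) : Prop :=
  let g := gh.1 in let h := gh.2 in
  match k with
  | 1 => (forall x, phi_plus g x = 1%E) /\ (forall x, phi_minus h x = 1%E)
  | 2 => (forall x, phi_plus g x = 1%E) /\ (forall x, phi_zero h x = 1%E)
  | 3 => (forall x, phi_zero g x = 1%E) /\ (forall x, phi_zero h x = 1%E)
  | 4 => (forall x, phi_zero g x = 0%E) /\ nonconstant (phi_plus g)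
         /\ nonconstant (phi_minus g) /\ (forall x, phi_zero h x = 1%E)
  | _ => False
  end.

End Defs.

(* Main.v *)
(* Write phi_+(x) and hat phi_+(x) for the probabilities of escaping to +oo
   under the two systems.  Two facts suffice.

   Dichotomy: if phi_+ is positive somewhere then phi_+ + phi_- = 1 everywhere.
   Indeed phi_+ is then positive everywhere, since shiftability lets any point
   be moved above any other one.  By monotonicity a trajectory that is at or
   above [a] escapes to +oo with probability at least phi_+(a), so the event of
   being above [a] infinitely often without escaping to +oo has conditional
   probability at most 1 - phi_+(a) < 1 given any finite past; such an event is
   null.  The same argument shows that a constant phi_+ is 0 or 1.

   Duality: phi_+(x) + hat phi_+(y) <= 1 for all [x] and [y].  The events
   F_n(x) > y and F_n^-1(y) > x are disjoint, and F_n^-1 has the law of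
   hat F_n because reversing the order of n i.i.d. maps preserves their law.

   If neither system oscillates, duality and its mirror image for phi_- are
   equalities, so that phi_+ and hat phi_+ are constants with sum 1. *)
Require Import Defs.
From HB Require Import structures.
From mathcomp Require Import all_boot all_order all_algebra.
From mathcomp Require Import all_classical all_reals all_analysis.
From mathcomp Require Import lra.
Import Order.TTheory GRing.Theory Num.Theory.
Import numFieldNormedType.Exports.
Local Open Scope classical_set_scope.
Local Open Scope ring_scope.

Set Implicit Arguments.
Unset Strict Implicit.
Unset Printing Implicit Defensive.

(** * The space of index sequences *)

Definition depends_on (I : Type) (n : nat) (T : set (nat -> I)) : Prop :=
  forall u v, (forall k, (k < n)%N -> u k = v k) -> T u -> T v.

Definition finite_time (I : Type) : set (set (nat -> I)) :=
  [set T | exists n, depends_on n T].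

(* The index [i0] only makes the space of sequences pointed, as required of a
   measurable type. *)
Definition index_seq (I : countType) (i0 : I) : Type := nat -> I.

HB.instance Definition _ (I : countType) (i0 : I) :=
  Choice.copy (index_seq i0) (nat -> I).
HB.instance Definition _ (I : countType) (i0 : I) :=
  isPointed.Build (index_seq i0) (fun=> i0).

Notation path_space i0 :=
  (g_sigma_algebraType (@finite_time _ : set (set (index_seq i0)))).

Section Words.
Context {I : countType} {i0 : I}.
Implicit Types (u v : nat -> I) (S T : set (path_space i0)).

Definition shift (n : nat) u : nat -> I := fun k => u (n + k)%N.

Definition cyl (n : nat) u : set (path_space i0) :=
  [set v | forall k, (k < n)%N -> v k = u k].

(** Countability of [I] turns the first [n] letters into one natural number, so that finite-time
    events split into countably many pieces, each a cylinder or empty. *)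
Definition code (n : nat) u : nat := pickle (mkseq u n).

Lemma codeP n u v : code n u = code n v <-> forall k, (k < n)%N -> u k = v k.
Proof.
split=> [/(pcan_inj pickleK) e k kn|e].
  by rewrite -(nth_mkseq (u k) u kn) e nth_mkseq.
congr pickle; apply: (@eq_from_nth _ (u 0%N)); rewrite ?size_mkseq// => k kn.
by rewrite !nth_mkseq// e.
Qed.

Lemma depends_onW m n T : (m <= n)%N -> depends_on m T -> depends_on n T.
Proof. by move=> mn mT u v e; apply: mT => k km; apply/e/(leq_trans km). Qed.

Lemma depends_on_cyl n u : depends_on n (cyl n u).
Proof. by move=> v w e vu k kn; rewrite -e// vu. Qed.

Lemma measurable_depends_on n T : depends_on n T -> measurable T.
Proof. by move=> nT; apply: sub_gen_smallest; exists n. Qed.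

Lemma measurable_cyl n u : measurable (cyl n u).
Proof. exact: measurable_depends_on (@depends_on_cyl n u). Qed.

Lemma depends_on_shift n m T :
  depends_on m T -> depends_on (n + m) (shift n @^-1` T).
Proof. by move=> mT u v e; apply: mT => k km; rewrite /shift e// ltn_add2l. Qed.

Lemma measurable_shift n S :
  measurable S -> measurable (shift n @^-1` S : set (path_space i0)).
Proof.
move=> mS; rewrite -[X in measurable X]setTI.
suff : measurable_fun setT (shift n : path_space i0 -> path_space i0).
  by apply; [exact: measurableT|].
apply: (@measurability _ _ (path_space i0) (path_space i0) setT (shift n)
  (@finite_time I) erefl) => _ [T [m mT] <-].
by rewrite setTI; apply: measurable_depends_on (depends_on_shift mT).
Qed.

Lemma measurable_code n k : measurable (code n @^-1` [set k] : set (path_space i0)).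
Proof.
by apply: (@measurable_depends_on n) => u v /codeP e /= <-; apply/esym.
Qed.

Lemma setI_code_cyl n T u : depends_on n T -> T u ->
  T `&` code n @^-1` [set code n u] = cyl n u.
Proof.
move=> nT Tu; apply/seteqP; split=> v /=; first by move=> [_ /codeP].
by move=> vu; split; [apply: nT Tu => k kn; rewrite vu|apply/codeP].
Qed.

End Words.

(** * The law of an i.i.d. index sequence, given on cylinders, and its Markov property *)

Section Law.
Context {I : countType} {i0 : I} {R : realType}.
Variables (p : I -> R) (Q : probability (path_space i0) R).
Hypothesis p_gt0 : forall i, 0 < p i.
Hypothesis Q_cyl : forall n s, Q (cyl n s) = (\prod_(k < n) p (s k))%:E.
Implicit Types (u v s : nat -> I) (S T : set (path_space i0)).
Local Open Scope ereal_scope.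

Lemma measure_fibers S (h : path_space i0 -> nat) : measurable S ->
  (forall k, measurable (h @^-1` [set k])) ->
  Q S = \sum_(k <oo) Q (S `&` h @^-1` [set k]).
Proof.
move=> mS mh.
have mSh k : measurable (S `&` h @^-1` [set k]) by exact: measurableI.
rewrite -measure_semi_bigcup//.
- congr (Q _); apply/seteqP; split=> [u Su|u [k _ []]//].
  by exists (h u).
- by move=> j k _ _ [u [[_ <-] [_ <-]]].
- exact: bigcup_measurable.
Qed.

Lemma cyl_gt0 n s : 0 < Q (cyl n s).
Proof. by rewrite Q_cyl lte_fin prodr_gt0. Qed.

Lemma markov_cyl n m s t :
  Q (cyl n s `&` shift n @^-1` (cyl m t : set (path_space i0))) = Q (cyl n s) * Q (cyl m t).
Proof.
(* The intersection is the cylinder of the concatenated word: [n] letters of [s], then those of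
   [t]. *)
pose r k := if (k < n)%N then s k else t (k - n)%N.
rewrite (_ : _ `&` _ = cyl (n + m) r).
  rewrite !Q_cyl big_split_ord /= EFinM /r; congr ((_ * _)%:E).
    by apply: eq_bigr => k _; rewrite ltn_ord.
  by apply: eq_bigr => k _; rewrite ltnNge leq_addr addKn.
apply/seteqP; split=> v /=.
  move=> [vs vt] k kn; rewrite /r; case: ifPn => [/vs//|]; rewrite -leqNgt => nk.
  have := vt (k - n)%N; rewrite /shift subnKC// => -> //.
  by rewrite ltn_subLR.
move=> vr; split=> k kn; rewrite ?/shift vr ?/r ?kn//.
- by rewrite (leq_trans kn)// leq_addr.
- by rewrite ltnNge leq_addr /= addKn.
- by rewrite ltn_add2l.
Qed.

(** The pi-lambda theorem: both sides are measures in [S], and finite-time events form a generating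
    pi-system. Such an event is a countable disjoint union of cylinders, for which [markov_cyl]
    applies. *)
Lemma markov n s S : measurable S ->
  Q (cyl n s `&` shift n @^-1` S) = Q (cyl n s) * Q S.
Proof.
have mc := @measurable_cyl I i0 n s.
have finQ (A : set (path_space i0)) : measurable A -> Q A \is a fin_num.
  by move=> mA; exact: fin_num_measure.
pose mP (S : set (path_space i0)) :=
  Q (cyl n s `&` shift n @^-1` S) = Q (cyl n s) * Q S.
move=> mS; rewrite -/(mP S); move: mS.
apply: (@dynkin_induction _ (path_space i0) (@finite_time I) mP).
- by [].
- move=> A B [a aA] [b bB]; exists (maxn a b) => u v e [Au Bu]; split.
    by apply: (depends_onW (leq_maxl a b) aA) Au.
  by apply: (depends_onW (leq_maxr a b) bB) Bu.
- by rewrite /mP preimage_setT setIT probability_setT mule1.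
- move=> T [m mT]; rewrite /mP.
  have mT' := measurable_depends_on mT : measurable (T : set (path_space i0)).
  rewrite (@measure_fibers _ (code m \o shift n)); last 2 first.
  + by apply: measurableI => //; exact: measurable_shift.
  + move=> k; rewrite comp_preimage; apply: measurable_shift.
    exact: measurable_code.
  rewrite (@measure_fibers T (code m))//; last by move=> k; exact: measurable_code.
  rewrite -(fineK (finQ _ mc)) -nneseriesZl//.
  apply: eq_eseriesr => k _; rewrite fineK ?finQ//.
  rewrite -setIA comp_preimage -preimage_setI.
  have [[u [Tu <-]]|nk] := pselect (exists u, T u /\ code m u = k).
    by rewrite setI_code_cyl// markov_cyl.
  rewrite (_ : T `&` _ = set0); last first.
    by apply/seteqP; split=> // u [Tu ku]; apply: nk; exists u.
  by rewrite preimage_set0 setI0 !measure0 mule0.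
- move=> A mA; rewrite /mP => PA.
  rewrite (_ : _ `&` _ = cyl n s `\` (shift n @^-1` A))// measureD//; last 2 first.
  + exact: measurable_shift.
  + by rewrite ltey_eq finQ.
  rewrite [X in _ - X](_ : _ = Q (cyl n s) * Q A)//.
  rewrite [Q (~` A)]probability_setC// muleBr ?mule1 ?finQ//.
- move=> F mF tF PF; rewrite /mP preimage_bigcup setI_bigcupr.
  rewrite measure_semi_bigcup//; last 3 first.
  + by move=> k; apply: measurableI => //; exact: measurable_shift.
  + move=> i j _ _ [u [[_ Fi] [_ Fj]]].
    by apply: (tF i j Logic.I Logic.I); exists (shift n u).
  + apply: bigcup_measurable => k _.
    by apply: measurableI => //; exact: measurable_shift.
  rewrite measure_semi_bigcup//; last exact: bigcup_measurable.
  rewrite -(fineK (finQ _ mc)) -nneseriesZl//.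
  by apply: eq_eseriesr => k _; rewrite fineK ?finQ//; exact: PF.
Qed.

Definition prob (A : set (path_space i0)) : R := fine (Q A).

Lemma probE A : measurable A -> Q A = (prob A)%:E.
Proof. by move=> mA; rewrite fineK// fin_num_measure. Qed.

Lemma prob_ge0 A : (0 <= prob A)%R.
Proof. by rewrite fine_ge0. Qed.

Lemma prob_le A B : measurable A -> measurable B -> A `<=` B -> (prob A <= prob B)%R.
Proof.
by move=> mA mB AB; rewrite fine_le ?le_measure ?inE ?fin_num_measure.
Qed.

Lemma prob_setDI A B : measurable A -> measurable B ->
  prob A = (prob (A `\` B) + prob (A `&` B))%R.
Proof.
move=> mA mB; rewrite {1}/prob (measureDI Q mA mB) fineD//; apply: fin_num_measure.
  exact: measurableD.
exact: measurableI.
Qed.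

(** * Approximation by finite-time events and null events *)

Definition approximable S := forall e : R, (0 < e)%R ->
  exists2 T : set (path_space i0), finite_time T & Q ((S `\` T) `|` (T `\` S)) <= e%:E.

(** Again by the pi-lambda theorem. A complement has the same symmetric difference; a countable
    union is first replaced by a finite one, at a cost of [e / 2]. *)
Lemma measurable_approx S : measurable S -> approximable S.
Proof.
have mD (A B : set (path_space i0)) : measurable A -> finite_time B ->
    measurable ((A `\` B) `|` (B `\` A)).
  move=> mA [n nB]; have mB := measurable_depends_on nB.
  by apply: measurableU; exact: measurableD.
apply: (@dynkin_induction _ (path_space i0) (@finite_time I) approximable).
- by [].
- move=> A B [a aA] [b bB]; exists (maxn a b) => u v e [Au Bu]; split.
    by apply: (depends_onW (leq_maxl a b) aA) Au.
  by apply: (depends_onW (leq_maxr a b) bB) Bu.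
- move=> e e0; exists setT; first by exists 0%N.
  by rewrite setDv setU0 measure0 lee_fin ltW.
- move=> T fT e e0; exists T => //.
  by rewrite setDv setU0 measure0 lee_fin ltW.
- move=> A mA aA e /aA[T [n nT] QT]; exists (~` T).
    by exists n => u v uv /= nTu Tv; apply/nTu/(nT v) => // k kn; rewrite uv.
  by rewrite !setDE !setCK setUC [~` A `&` _]setIC [~` T `&` _]setIC -!setDE.
- move=> F mF tF aF e e0.
  have e20 : (0 < e / 2)%R by rewrite divr_gt0.
  pose G n := \big[setU/set0]_(k < n) F k.
  have mG n : measurable (G n) by apply: bigsetU_measurable => k _; exact: mF.
  have mUF : measurable (\bigcup_k F k) by exact: bigcup_measurable.
  (* Errors add up under unions, so each of the two sets joined gets half of the tolerance. *)
  have aG n : approximable (G n).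
    elim: n => [|n IHn] d d0; first exists set0.
    + by exists 0%N.
    + by rewrite /G big_ord0 setDv setU0 measure0 lee_fin ltW.
    have d20 : (0 < d / 2)%R by rewrite divr_gt0.
    have [T fT QT] := IHn _ d20; have [T' fT' QT'] := aF n _ d20.
    have fTT : finite_time (T `|` T').
      move: fT fT' => [a aT] [b bT]; exists (maxn a b) => u v uv.
      move=> [Tu|Tu]; [left|right].
        by apply: (depends_onW (leq_maxl a b) aT) Tu.
      by apply: (depends_onW (leq_maxr a b) bT) Tu.
    exists (T `|` T') => //.
    rewrite [d]splitr EFinD; apply: le_trans (leeD QT QT').
    apply: le_trans (measureU2 _ _ _); [|exact: mD|exact: mD].
    rewrite le_measure ?inE//.
    + by apply: mD => //; exact: mG.
    + by apply: measurableU; exact: mD.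
    rewrite /G big_ord_recr/= -/(G n) => u /=.
    have [] := pselect (T u); have [] := pselect (T' u); tauto.
  have GF : \bigcup_n G n = \bigcup_k F k.
    apply/seteqP; split=> u [n _]; rewrite /G.
      by rewrite -bigcup_mkord => -[k _ Fk]; exists k.
    by move=> Fu; exists n.+1 => //; rewrite /G -bigcup_mkord; exists n => /=.
  (* Continuity from below provides [N] such that [G N] misses at most [e / 2] of the union. *)
  have := @nondecreasing_cvg_mu _ _ _ Q G mG.
  rewrite GF => /(_ mUF) => h.
  have : Q \o G @ \oo --> Q (\bigcup_k F k).
    by apply: h; move=> i j ij; apply/subsetPset; exact: subset_bigsetU.
  have fUF : Q (\bigcup_k F k) \is a fin_num by exact: fin_num_measure.
  rewrite -(fineK fUF) => /fine_cvgP[_] /cvgrPdist_le/(_ _ e20)[N _ /(_ N (leqnn N))].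
  rewrite /= => QN.
  have [T fT QT] := aG N _ e20.
  have [n nT] := fT; have mT := measurable_depends_on nT.
  exists T => //.
  have mDG : measurable (\bigcup_k F k `\` G N) by exact: measurableD.
  rewrite [e]splitr EFinD.
  apply: (@le_trans _ _ (Q (\bigcup_k F k `\` G N) +
      Q ((G N `\` T) `|` (T `\` G N)))).
    apply: le_trans (measureU2 _ _ _); [|exact: mDG|exact: mD].
    rewrite le_measure ?inE//; first exact: mD.
      by apply: measurableU => //; exact: mD.
    have GNF : G N `<=` \bigcup_k F k by rewrite -GF => u Gu; exists N.
    move=> u; have := GNF u; rewrite /setU /setD /mkset.
    have [] := pselect (G N u); tauto.
  apply: leeD => //.
  have GNF : G N `<=` \bigcup_k F k by rewrite -GF => u Gu; exists N.
  have := prob_setDI mUF (mG N).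
  rewrite [_ `&` G N](_ : _ = G N); last by rewrite setIC; apply/setIidPl.
  rewrite /prob => QD; rewrite probE// lee_fin.
  apply: le_trans QN; rewrite QD addrK; exact: ler_norm.
Qed.

(** A Lebesgue-density argument: if [T] nearly equals [S], then Q(S) is close to Q(S n T), which is
    at most c Q(T), itself close to c Q(S). *)
Lemma small_density_null S (c : R) : measurable S -> (0 <= c < 1)%R ->
  (forall T, finite_time T -> Q (S `&` T) <= c%:E * Q T) -> Q S = 0.
Proof.
move=> mS /andP[c0 c1] QST.
suff s0 : (prob S <= 0)%R.
  by apply/le_anti; rewrite measure_ge0 andbT probE// lee_fin.
apply/ler_addgt0Pr => e e0; rewrite add0r.
(* The hypothesis gives (1 - c) Q(S) <= Q(S - T) + Q(T - S) <= [d], hence Q(S) <= e / 2. *)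
pose d := ((1 - c) / 2 * e)%R.
have d0 : (0 < d)%R by rewrite mulr_gt0// divr_gt0// subr_gt0.
have [T fT] := measurable_approx mS d0; have [n nT] := fT.
have mT := measurable_depends_on nT : measurable (T : set (path_space i0)).
have mD1 : measurable (S `\` T) by exact: measurableD.
have mD2 : measurable (T `\` S) by exact: measurableD.
have mST : measurable (S `&` T) by exact: measurableI.
have mTS : measurable (T `&` S) by exact: measurableI.
move=> QT; have : Q (S `\` T) + Q (T `\` S) <= d%:E.
  apply: le_trans QT; rewrite measureU//.
  by apply/seteqP; split=> // u [[? ?] []].
move: (prob_setDI mS mT) (prob_setDI mT mS) (QST _ fT).
move: (prob_ge0 (S `\` T)) (prob_ge0 (T `\` S)).
rewrite [T `&` S]setIC (probE mT) (probE mST) (probE mD1) (probE mD2).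
rewrite -!EFinD -EFinM !lee_fin /d.
move: (prob S) (prob T) (prob _) (prob _) (prob _) => s t x y z.
move=> *; nra.
Qed.

(** Countable additivity. It serves below for the cylinders of a finite-time event and for the first
    times at or above a level. *)
Lemma measure_cover_le S (B : nat -> set (path_space i0)) (c : R) :
  measurable S -> (forall k, measurable (B k)) -> trivIset setT B ->
  S `<=` \bigcup_k B k -> (forall k, Q (S `&` B k) <= c%:E * Q (B k)) ->
  Q S <= c%:E * Q (\bigcup_k B k).
Proof.
move=> mS mB tB SB QSB.
rewrite -(setIidl SB) setI_bigcupr.
have mSB k : measurable (S `&` B k) by exact: measurableI.
rewrite measure_semi_bigcup//; last 2 first.
- by move=> i j _ _ [u [[_ Bi] [_ Bj]]]; apply: (tB i j Logic.I Logic.I); exists u.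
- exact: bigcup_measurable.
rewrite measure_semi_bigcup//; last exact: bigcup_measurable.
rewrite -nneseriesZl//; apply: lee_nneseries => [k _ _|k _].
  exact: measure_ge0.
exact: QSB.
Qed.

Lemma measure_finite_time_le n T S (c : R) : measurable S -> depends_on n T ->
  (forall u, T u -> Q (S `&` cyl n u) <= c%:E * Q (cyl n u)) ->
  Q (S `&` T) <= c%:E * Q T.
Proof.
move=> mS nT QS; have mT := measurable_depends_on nT.
pose B k : set (path_space i0) := T `&` code n @^-1` [set k].
have mB k : measurable (B k) by apply: measurableI => //; exact: measurable_code.
have TB : T = \bigcup_k B k.
  by apply/seteqP; split=> [u Tu|u [k _ []]//]; exists (code n u).
rewrite [X in _ * Q X]TB; apply: measure_cover_le => //.
- exact: measurableI.
- by move=> i j _ _ [u [[_ <-] [_ <-]]].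
- by rewrite -TB => u [].
- move=> k; have [[u [Tu <-]]|nk] := pselect (exists u, T u /\ code n u = k).
    rewrite /B setI_code_cyl//; apply: le_trans (QS _ Tu).
    rewrite le_measure ?inE//.
    + by apply: measurableI; [exact: measurableI|exact: measurable_cyl].
    + by apply: measurableI => //; exact: measurable_cyl.
    + by move=> v [[]].
  rewrite (_ : B k = set0) ?setI0 ?measure0 ?mule0//.
  by apply/seteqP; split=> // u [Tu ku]; apply: nk; exists u.
Qed.

(** * Random compositions *)

Definition coord (k : nat) (u : path_space i0) : I := u k.

Section Dynamics.
Variable g : I -> R -> R.
Implicit Types x y z a b : R.
Local Notation F := (iterF g coord).

Lemma iterF_agree n u v x : (forall k, (k < n)%N -> u k = v k) ->
  F n u x = F n v x.
Proof.
elim: n => //= n IHn e; rewrite /coord e// IHn// => k kn.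
by apply: e; rewrite (leq_trans kn).
Qed.

Lemma iterF_add n m u x : F (n + m)%N u x = F m (shift n u) (F n u x).
Proof. by elim: m => [|m IHm]; rewrite ?addn0// addnS /= IHm. Qed.

Lemma depends_on_iterF n x (A : set R) : depends_on n [set u | A (F n u x)].
Proof. by move=> u v e /=; rewrite (iterF_agree x e). Qed.

Lemma measurable_iterF n x (A : set R) : measurable [set u | A (F n u x)].
Proof. exact: measurable_depends_on (@depends_on_iterF n x A). Qed.

(** [S z] is read as an event about the trajectory issued from [z]; it has to persist when the
    trajectory is restarted at time [n] from its current position. *)
Definition shift_stable (S : R -> set (path_space i0)) :=
  forall n u z, S z u -> S (F n u z) (shift n u).

(** On the cylinder the position at time [n] is a constant, so [S z] forces an event of the shifted
    sequence, which is independent of the cylinder. *)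
Lemma shift_stable_cyl_le (S : R -> set (path_space i0)) n u z (c : R) :
  (forall z, measurable (S z)) -> shift_stable S ->
  Q (S (F n u z)) <= c%:E -> Q (S z `&` cyl n u) <= c%:E * Q (cyl n u).
Proof.
move=> mS sS Qc; have mc := @measurable_cyl _ i0 n u.
have mSs := measurable_shift n (mS (F n u z)).
apply: (@le_trans _ _ (Q (cyl n u `&` shift n @^-1` S (F n u z)))).
  rewrite le_measure ?inE//; [exact: measurableI|exact: measurableI|].
  by move=> v [Sv uv]; split=> //=; rewrite -(iterF_agree z uv); exact: sS.
by rewrite markov// muleC lee_wpmul2r.
Qed.

(* By the Markov property such an event has conditional probability at most
   [c] given any finite past, and it is approximated by finite-time events. *)
Lemma shift_stable_null (S : R -> set (path_space i0)) (c : R) :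
  (forall z, measurable (S z)) -> shift_stable S -> (0 <= c < 1)%R ->
  (forall z, Q (S z) <= c%:E) -> forall z, Q (S z) = 0.
Proof.
move=> mS sS c01 Qc z; apply: small_density_null c01 _ => // T [n nT].
by apply: measure_finite_time_le nT _ => // u _; exact: shift_stable_cyl_le.
Qed.

(** * Escape to +oo and recurrence above a level *)

Definition to_pinfty z : set (path_space i0) :=
  [set u | (fun n => F n u z) @ \oo --> +oo_R].

Definition recurrent_above a z : set (path_space i0) :=
  [set u | forall N, exists2 n, (N <= n)%N & (a <= F n u z)%R].

Lemma to_pinftyP z u :
  to_pinfty z u <-> forall M : R, exists N, forall n, (N <= n)%N -> (M <= F n u z)%R.
Proof.
split=> [/cvgryPge h M|h]; first by have [N _ hN] := h M; exists N.
by apply/cvgryPge => M; have [N hN] := h M; exists N.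
Qed.

Lemma measurable_to_pinfty z : measurable (to_pinfty z).
Proof.
rewrite (_ : to_pinfty z = \bigcap_(M : nat) \bigcup_N
    \bigcap_(n in [set n | (N <= n)%N]) [set u | (M%:R <= F n u z)%R]).
  apply: bigcapT_measurable => M; apply: bigcup_measurable => N _.
  apply: bigcap_measurable; first by exists N => /=.
  by move=> n _; exact: (@measurable_iterF n z [set y | (M%:R <= y)%R]).
apply/seteqP; split=> [u /to_pinftyP h M _|u h].
  by have [N hN] := h M%:R; exists N.
apply/to_pinftyP => M; have [N _ hN] := h (Num.truncn M).+1 Logic.I.
exists N => n Nn; apply: le_trans (hN n Nn).
exact/ltW/truncnS_gt.
Qed.

Lemma measurable_recurrent_above a z : measurable (recurrent_above a z).
Proof.
rewrite (_ : recurrent_above a z = \bigcap_(N : nat)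
    \bigcup_(n in [set n | (N <= n)%N]) [set u | (a <= F n u z)%R]).
  apply: bigcapT_measurable => N; apply: bigcup_measurable => n _.
  exact: (@measurable_iterF n z [set y | (a <= y)%R]).
apply/seteqP; split=> [u h N _|u h N]; first by have [n] := h N; exists n.
by have [n Nn] := h N Logic.I; exists n.
Qed.

Lemma to_pinfty_shift n u z :
  to_pinfty z u <-> to_pinfty (F n u z) (shift n u).
Proof.
split=> /to_pinftyP h; apply/to_pinftyP => M; have [N hN] := h M.
  by exists N => m Nm; rewrite -iterF_add hN// (leq_trans Nm)// leq_addl.
exists (n + N)%N => m nNm; have nm : (n <= m)%N by rewrite (leq_trans _ nNm)// leq_addr.
by rewrite -(subnKC nm) iterF_add hN// leq_subRL.
Qed.

Lemma recurrent_above_shift a : shift_stable (recurrent_above a).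
Proof.
move=> n u z h N; have [m nNm am] := h (n + N)%N.
have nm : (n <= m)%N by rewrite (leq_trans _ nNm)// leq_addr.
by exists (m - n)%N; rewrite ?leq_subRL// -iterF_add subnKC.
Qed.

Hypothesis g_mono : forall i, {homo g i : x y / (x < y)%R}.

Lemma iterF_le n u x y : (x <= y)%R -> (F n u x <= F n u y)%R.
Proof. by move=> xy; elim: n => //= n IHn; exact/(ltW_homo (g_mono _)). Qed.

Lemma to_pinfty_le x y : (x <= y)%R -> to_pinfty x `<=` to_pinfty y.
Proof.
move=> xy u /to_pinftyP h; apply/to_pinftyP => M; have [N hN] := h M.
by exists N => n Nn; apply: le_trans (hN n Nn) (iterF_le _ _ xy).
Qed.

(** From a point at or above [a], monotonicity bounds the probability of not escaping by 1 -
    phi_+(a). Other starting points inherit this bound at their first passage above [a], and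
    [shift_stable_null] concludes. *)
Lemma recurrent_not_to_pinfty_null a z : 0 < Q (to_pinfty a) ->
  Q (recurrent_above a z `\` to_pinfty z) = 0.
Proof.
have mup := measurable_to_pinfty.
rewrite (probE (mup a)) lte_fin => pa.
pose S z := recurrent_above a z `\` to_pinfty z.
have mS y : measurable (S y).
  by apply: measurableD => //; exact: measurable_recurrent_above.
have sS : shift_stable S.
  move=> n u y [ru nu]; split; first exact: recurrent_above_shift.
  by move/(to_pinfty_shift n u y).2.
pose c := (1 - prob (to_pinfty a))%R.
have c0 : (0 <= c)%R.
  by rewrite subr_ge0 -lee_fin -probE//; exact: probability_le1.
apply: (@shift_stable_null S c _ _ _ _ z) => //.
  by rewrite c0 /c ltrBlDr ltrDl.
have Sa y : (a <= y)%R -> Q (S y) <= c%:E.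
  move=> ay; rewrite EFinB -probE// -probability_setC//.
  rewrite le_measure ?inE//; first exact: measurableC.
  by move=> u [_ nu]; apply: contra_not nu; exact: to_pinfty_le.
move=> {}z.
(* On [B n] the first time at or above [a] is [n], and the trajectory restarted then satisfies the
   bound [Sa]. Recurrence makes these disjoint events cover [S z]. *)
pose B n := [set u | (a <= F n u z)%R] `&`
  [set u | forall k, (k < n)%N -> (F k u z < a)%R].
have nB n : depends_on n (B n).
  move=> u v e [au bu]; split=> /=; first by rewrite -(iterF_agree z e).
  move=> k kn; rewrite -(@iterF_agree k u)//; first exact: bu.
  by move=> j jk; apply: e; exact: ltn_trans kn.
have mB n : measurable (B n) by exact: measurable_depends_on (nB n).
have mUB : measurable (\bigcup_n B n) by exact: bigcup_measurable.
apply: (@le_trans _ _ (c%:E * Q (\bigcup_n B n))).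
  apply: measure_cover_le => //.
  - apply/trivIsetP => i j _ _ ij; apply/seteqP; split=> // u [[/= ai bi] [/= aj bj]].
    case: (ltngtP i j) ij => // ij _.
      by have := bj _ ij; rewrite ltNge ai.
    by have := bi _ ij; rewrite ltNge aj.
  - move=> u [ru _]; have ex : exists n, (a <= F n u z)%R.
      by have [n _ an] := ru 0%N; exists n.
    exists (ex_minn ex) => //; case: ex_minnP => n an min; split=> //= k kn.
    by rewrite ltNge; apply: contraL kn => /min; rewrite -leqNgt.
  - move=> n; apply: measure_finite_time_le (nB n) _ => // u [au _].
    by apply: shift_stable_cyl_le => //; exact: Sa.
by rewrite -[leRHS]mule1 lee_wpmul2l// ?lee_fin//; exact: probability_le1.
Qed.

End Dynamics.

(** * Escape to -oo, symmetries, and the dichotomy *)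

Implicit Types (g h : I -> R -> R) (x y z a : R).

Definition to_ninfty (g : I -> R -> R) z : set (path_space i0) :=
  [set u | (fun n => iterF g coord n u z) @ \oo --> -oo_R].

Lemma iterF_conj g n u x :
  iterF (conj_minus g) coord n u x = (- iterF g coord n u (- x))%R.
Proof. by elim: n => [|n IHn]; rewrite /= ?opprK// IHn /conj_minus opprK. Qed.

(** Through this identity every fact about escape to +oo yields its mirror image for -oo. *)
Lemma to_ninfty_conj g z : to_ninfty g z = to_pinfty (conj_minus g) (- z).
Proof.
by apply/seteqP; split=> u; rewrite /to_ninfty /to_pinfty /mkset;
  under [in X in _ -> X]eq_fun do rewrite ?iterF_conj ?opprK;
  under [in X in X -> _]eq_fun do rewrite ?iterF_conj ?opprK; move=> /cvgNry.
Qed.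

Lemma measurable_to_ninfty g z : measurable (to_ninfty g z).
Proof. by rewrite to_ninfty_conj; exact: measurable_to_pinfty. Qed.

(** The hypotheses in a form stable under both allowed transformations, as the next two lemmas
    show. *)
Definition shiftable_pair (g h : I -> R -> R) := [/\
  forall i, {homo g i : x y / (x < y)%R},
  forall i, cancel (g i) (h i), forall i, cancel (h i) (g i) &
  forall x, exists i j, (g j x < x < g i x)%R].

Lemma shiftable_pair_sym g h : shiftable_pair g h -> shiftable_pair h g.
Proof.
move=> [gm gh hg sh].
have hm i : {homo h i : x y / (x < y)%R}.
  move=> x y xy; rewrite ltNge; apply: contraTN xy => hyx.
  by rewrite -leNgt -(hg i x) -(hg i y); exact/(ltW_homo (gm i)).
split=> // x; have [i [j /andP[jx xi]]] := sh x; exists j, i.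
by have := hm i _ _ xi; have := hm j _ _ jx; rewrite !gh => -> ->.
Qed.

Lemma shiftable_pair_conj g h :
  shiftable_pair g h -> shiftable_pair (conj_minus g) (conj_minus h).
Proof.
rewrite /conj_minus => -[gm gh hg sh]; split.
- by move=> i x y xy; rewrite ltrN2 gm// ltrN2.
- by move=> i x; rewrite opprK gh opprK.
- by move=> i x; rewrite opprK hg opprK.
- move=> x; have [i [j /andP[jx xi]]] := sh (- x)%R; exists j, i.
  by rewrite ltrNl xi ltrNr.
Qed.

(* At the supremum [s] of the reachable points some map pushes [s] to the right,
   and so does it with a reachable point close to [s]. *)
Lemma reach_above g h x y : shiftable_pair g h ->
  exists n u, (y <= iterF g coord n u x)%R.
Proof.
move=> [gm gh hg sh]; apply: contrapT => no.
pose A := [set r | exists n u, r = iterF g coord n u x].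
have Ay : ubound A y.
  move=> _ [n [u ->]]; rewrite leNgt; apply/negP => /ltW yu.
  by apply: no; exists n, u.
have A0 : A !=set0 by exists x, 0%N, (fun=> i0).
have hA : has_sup A by split=> //; exists y.
have [i [j /andP[_ si]]] := sh (sup A).
have his : (h i (sup A) < sup A)%R.
  have [gm' _ _ _] := shiftable_pair_sym (And4 gm gh hg sh).
  by have := gm' i _ _ si; rewrite gh.
have [_ [n [u ->]] ru] := sup_gt A0 his.
have := gm i _ _ ru; rewrite hg; apply/negP; rewrite -leNgt.
apply: ub_le_sup; first by case: hA.
pose v k := if (k < n)%N then u k else i; exists n.+1, v => /=.
rewrite (_ : coord n v = i); last by rewrite /coord /v ltnn.
congr (g i _); apply: iterF_agree => k kn.
by rewrite /v kn.
Qed.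

(** With positive probability the trajectory of [a] first follows a finite word leading it to or
    above [y]; independently of that word, the rest of the sequence makes [y] escape. *)
Lemma prob_to_pinfty_gt0 g h a y : shiftable_pair g h ->
  (0 < prob (to_pinfty g y))%R -> (0 < prob (to_pinfty g a))%R.
Proof.
move=> gh py; have [gm _ _ _] := gh.
have [n [u yu]] := reach_above a y gh.
have mup := measurable_to_pinfty g; have mc := @measurable_cyl _ i0 n u.
have : (0 < prob (cyl n u `&` shift n @^-1` to_pinfty g y))%R.
  have := markov n u (mup y); rewrite {1}/prob => ->.
  by rewrite fineM ?fin_num_measure// mulr_gt0// -lte_fin -probE// cyl_gt0.
move/lt_le_trans; apply; apply: prob_le => //.
  by apply: measurableI => //; exact: measurable_shift.
move=> v [uv yv]; apply/(to_pinfty_shift g n v a).2.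
by rewrite (iterF_agree g a uv); exact: to_pinfty_le yu _ yv.
Qed.

Lemma to_infty_disjoint g x : to_pinfty g x `&` to_ninfty g x = set0.
Proof.
apply/seteqP; split=> // u [/cvgryPge/(_ 0%R)[N _ hN]].
move=> /cvgrNyPlt/(_ 0%R)[M _ hM].
have := hM (maxn N M) (leq_maxr _ _); have := hN (maxn N M) (leq_maxl _ _).
by move=> /= ?; rewrite ltNge => /negP.
Qed.

Lemma prob_to_infty_le1 g x :
  (prob (to_pinfty g x) + prob (to_ninfty g x) <= 1)%R.
Proof.
have mA := measurable_to_pinfty g x; have mB := measurable_to_ninfty g x.
rewrite -lee_fin EFinD -!probE//.
have <- := measureU Q mA mB (to_infty_disjoint g x).
by apply: probability_le1; exact: measurableU.
Qed.

(** A trajectory not tending to -oo is infinitely often above some level, hence above some integer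
    level [-m]. For each [m] this happens without escape to +oo only on a null event. *)
Lemma prob_to_infty_eq1 g h y x : shiftable_pair g h ->
  (0 < prob (to_pinfty g y))%R ->
  (prob (to_pinfty g x) + prob (to_ninfty g x) = 1)%R.
Proof.
move=> gh py; have [gm _ _ _] := gh.
have mA := measurable_to_pinfty g x; have mB := measurable_to_ninfty g x.
have mAB : measurable (to_pinfty g x `|` to_ninfty g x) by exact: measurableU.
have C0 : Q (~` (to_pinfty g x `|` to_ninfty g x)) = 0.
  apply: measure_negligible; first exact: measurableC.
  pose E (m : nat) := recurrent_above g (- m%:R)%R x `\` to_pinfty g x.
  apply: (@negligibleS _ _ _ _ (\bigcup_m E m)); last first.
    apply: negligible_bigcup => m; apply/negligibleP.
      by apply: measurableD => //; exact: measurable_recurrent_above.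
    apply: recurrent_not_to_pinfty_null => //.
    by rewrite probE ?lte_fin ?(prob_to_pinfty_gt0 _ gh py)//; exact: measurable_to_pinfty.
  move=> u nu; have nA : ~ to_pinfty g x u by move=> ?; apply: nu; left.
  have : ~ to_ninfty g x u by move=> ?; apply: nu; right.
  move=> nB; apply: contrapT => nE; apply: nB; apply/cvgrNyPle => M.
  (* The chosen integer exceeds [- M], so its opposite is a level below [M]. *)
  apply: contrapT => nM; apply: nE; exists (Num.truncn (- M)).+1 => //; split=> // N.
  apply: contrapT => nN; apply: nM; exists N => // n Nn /=.
  rewrite leNgt; apply/negP => Mn; apply: nN; exists n => //.
  apply: le_trans (ltW Mn); rewrite lerNl; exact/ltW/truncnS_gt.
have AB1 : Q (to_pinfty g x `|` to_ninfty g x) = 1.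
  move: C0; rewrite probability_setC// probE//.
  by rewrite -EFinB => -[] /eqP; rewrite subr_eq0 => /eqP <-.
have : Q (to_pinfty g x `|` to_ninfty g x) = Q (to_pinfty g x) + Q (to_ninfty g x).
  exact: measureU mA mB (to_infty_disjoint g x).
by rewrite AB1 !probE// -EFinD => -[].
Qed.

(** * Time reversal *)

Definition reversal n (u : nat -> I) : nat -> I :=
  fun k => if (k < n)%N then u (n - k.+1)%N else u k.

Lemma depends_on_reversal n T : depends_on n T ->
  depends_on n (reversal n @^-1` T).
Proof.
move=> nT u v e; apply: nT => k kn; rewrite /reversal kn e//.
by rewrite ltn_subrL (leq_ltn_trans _ kn).
Qed.

Lemma cyl_reversal n s : 
  reversal n @^-1` @cyl I i0 n s = @cyl I i0 n (reversal n s).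
Proof.
apply/seteqP; split=> u h k kn /=.
  have nk : (n - k.+1 < n)%N by rewrite ltn_subrL (leq_ltn_trans _ kn).
  have := h _ nk; rewrite /reversal nk kn => <-.
  by rewrite -subSn// subSS subKn// ltnW.
have nk : (n - k.+1 < n)%N by rewrite ltn_subrL (leq_ltn_trans _ kn).
rewrite /reversal kn (h _ nk) /reversal nk.
by rewrite -subSn// subSS subKn// ltnW.
Qed.

(** On a cylinder, reversal only permutes the factors of the product of weights; a finite-time event
    is a countable disjoint union of cylinders. *)
Lemma measure_reversal n T : depends_on n T -> Q (reversal n @^-1` T) = Q T.
Proof.
move=> nT.
rewrite (@measure_fibers _ (code n \o reversal n)); last 2 first.
- exact: measurable_depends_on (depends_on_reversal nT).
- move=> k; rewrite comp_preimage.
  apply: (@measurable_depends_on _ _ n); apply: depends_on_reversal.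
  by move=> u v /codeP e /= <-; apply/esym.
rewrite [RHS](@measure_fibers _ (code n)); last 2 first.
- exact: measurable_depends_on nT.
- by move=> k; exact: measurable_code.
apply: eq_eseriesr => k _; rewrite comp_preimage -preimage_setI.
have [[u [Tu <-]]|nk] := pselect (exists u, T u /\ code n u = k).
  rewrite setI_code_cyl// cyl_reversal !Q_cyl (reindex_inj rev_ord_inj)/=.
  congr (_%:E); apply: eq_bigr => j _; rewrite /reversal.
  by rewrite ltn_subrL (leq_ltn_trans _ (ltn_ord j))//= -subSn// subSS subKn// ltnW.
rewrite (_ : T `&` _ = set0) ?preimage_set0//.
by apply/seteqP; split=> // u [Tu ku]; apply: nk; exists u.
Qed.

(** The inverse of F_n applies the inverse of the last map first, which is the order in which the
    reversed word is read. *)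
Lemma iterF_reversal g h n u x : (forall i, cancel (g i) (h i)) ->
  iterF h coord n (reversal n u) (iterF g coord n u x) = x.
Proof.
move=> gh; elim: n => // n IHn.
(* The first letter of the reversed word is [u n], which undoes the last map; what remains is the
   reversal of the first [n] letters. *)
rewrite -{1}add1n iterF_add -[RHS]IHn /= {2}/coord /reversal /= subn1 /= gh.
apply: iterF_agree => k kn.
by rewrite /shift add1n ltnS kn subSS.
Qed.

(** A Fatou-type bound: escape to +oo lies in the increasing union of the events [D N] that the
    trajectory stays above [y] from time [N] on, and measure is continuous from below. *)
Lemma prob_above_lower_limit g x y e : (0 < e)%R -> exists N, forall n, (N <= n)%N ->
  (prob (to_pinfty g x) - e <= prob [set u | (y < iterF g coord n u x)%R])%R.
Proof.
move=> e0; pose A n : set (path_space i0) := [set u | (y < iterF g coord n u x)%R].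
have mA n : measurable (A n) by exact: (@measurable_iterF g n x [set z | (y < z)%R]).
pose D N := \bigcap_(n in [set n | (N <= n)%N]) A n.
have mD N : measurable (D N).
  by apply: bigcap_measurable; [exists N => /=|move=> n _].
have mUD : measurable (\bigcup_N D N) by exact: bigcup_measurable.
have nD : nondecreasing_seq D.
  move=> i j ij; apply/subsetPset => u Du n /= jn; apply: Du => /=.
  exact: leq_trans jn.
have : Q \o D @ \oo --> Q (\bigcup_N D N) by exact: nondecreasing_cvg_mu.
rewrite probE// => /fine_cvgP[_] /cvgrPdist_le/(_ _ e0)[N _ /(_ N (leqnn N))] /=.
rewrite -/(prob (D N)) => DN; exists N => n Nn.
apply: (@le_trans _ _ (prob (D N))); last by apply: (@prob_le _ (A n)) => // u; exact.
have : (prob (to_pinfty g x) <= prob (\bigcup_N D N))%R.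
  apply: prob_le => //; first exact: measurable_to_pinfty.
  by move=> u /cvgryPgt/(_ y)[M _ hM]; exists M.
move: (le_trans (ler_norm _) DN); lra.
Qed.

(* [F_n x > y] and, for the reversed word, [hat F_n y > x] exclude each other. *)
Lemma prob_duality g h x y : shiftable_pair g h ->
  (prob (to_pinfty g x) + prob (to_pinfty h y) <= 1)%R.
Proof.
move=> gh; have [hm _ _ _] := shiftable_pair_sym gh; have [_ cgh _ _] := gh.
apply/ler_addgt0Pr => e e0; have e20 : (0 < e / 2)%R by rewrite divr_gt0.
have [N hN] := prob_above_lower_limit g x y e20.
have [M hM] := prob_above_lower_limit h y x e20.
(* Both lower bounds are needed at one common time, since reversal relates the two systems at a
   fixed [n]. *)
pose n := maxn N M.
pose A : set (path_space i0) := [set u | (y < iterF g coord n u x)%R].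
pose B : set (path_space i0) := [set u | (x < iterF h coord n u y)%R].
have nB : depends_on n B by exact: (@depends_on_iterF h n y [set z | (x < z)%R]).
have mA : measurable A by exact: (@measurable_iterF g n x [set z | (y < z)%R]).
have mB' : measurable (reversal n @^-1` B : set (path_space i0)).
  exact: measurable_depends_on (depends_on_reversal nB).
have AB0 : A `&` reversal n @^-1` B = set0.
  apply/seteqP; split=> // u [/= yu]; rewrite /B /mkset ltNge => /negP; apply.
  (* If [y] is below F_n(x), monotonicity of the reversed inverse composition sends [y] to a point
     at most [x]. *)
  by rewrite -[leRHS](iterF_reversal n u x cgh) iterF_le// ltW.
have : Q A + Q (reversal n @^-1` B) <= 1.
  rewrite -(measureU Q mA mB' AB0); apply: probability_le1; exact: measurableU.
rewrite (measure_reversal nB) !probE//; last exact: measurable_depends_on nB.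
rewrite -EFinD lee_fin.
have := hN n (leq_maxl _ _); have := hM n (leq_maxr _ _).
rewrite -/A -/B; lra.
Qed.

(** * Classification *)

Definition escapes_up g := forall x, prob (to_pinfty g x) = 1%R.
Definition escapes_down g := forall x, prob (to_ninfty g x) = 1%R.
Definition oscillates g := forall x,
  prob (to_pinfty g x) = 0%R /\ prob (to_ninfty g x) = 0%R.
Definition escapes g := forall x,
  (prob (to_pinfty g x) + prob (to_ninfty g x) = 1)%R.
Definition escapes_both_ways g := [/\ escapes g,
  exists x y, prob (to_pinfty g x) <> prob (to_pinfty g y) &
  exists x y, prob (to_ninfty g x) <> prob (to_ninfty g y)].
Definition escapes_one_way g := escapes_up g \/ escapes_down g.

Lemma conj_minusK g : conj_minus (conj_minus g) = g.
Proof. by apply/funext => i; apply/funext => x; rewrite /conj_minus !opprK. Qed.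

Lemma to_pinfty_conj g z : to_pinfty g z = to_ninfty (conj_minus g) (- z).
Proof. by rewrite to_ninfty_conj conj_minusK opprK. Qed.

Lemma escapes_up_conj g : escapes_up (conj_minus g) <-> escapes_down g.
Proof.
split=> h x; first by rewrite to_ninfty_conj h.
by rewrite to_pinfty_conj conj_minusK h.
Qed.

Lemma escapes_down_conj g : escapes_down (conj_minus g) <-> escapes_up g.
Proof. by rewrite -escapes_up_conj conj_minusK. Qed.

Lemma oscillates_conj g : oscillates (conj_minus g) <-> oscillates g.
Proof.
suff H g' : oscillates g' -> oscillates (conj_minus g').
  by split=> [/H|/H//]; rewrite conj_minusK.
move=> h x; rewrite [to_ninfty _ x]to_ninfty_conj [to_pinfty _ x]to_pinfty_conj.
by rewrite conj_minusK; have [] := h (- x)%R.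
Qed.

Lemma escapes_both_ways_conj g :
  escapes_both_ways (conj_minus g) <-> escapes_both_ways g.
Proof.
suff H g' : escapes_both_ways g' -> escapes_both_ways (conj_minus g').
  by split=> [/H|/H//]; rewrite conj_minusK.
move=> [e [x [y pxy]] [z [t nzt]]]; split.
- move=> w; rewrite [to_ninfty _ w]to_ninfty_conj [to_pinfty _ w]to_pinfty_conj.
  by rewrite conj_minusK addrC e.
- exists (- z)%R, (- t)%R.
  by rewrite [to_pinfty _ (- z)]to_pinfty_conj [to_pinfty _ (- t)]to_pinfty_conj conj_minusK !opprK.
- exists (- x)%R, (- y)%R.
  by rewrite [to_ninfty _ (- x)]to_ninfty_conj [to_ninfty _ (- y)]to_ninfty_conj conj_minusK !opprK.
Qed.

Lemma escapes_one_way_conj g :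
  escapes_one_way (conj_minus g) <-> escapes_one_way g.
Proof.
by rewrite /escapes_one_way escapes_up_conj escapes_down_conj or_comm.
Qed.

Lemma escapes_of_gt0 g h x : shiftable_pair g h ->
  (0 < prob (to_pinfty g x) + prob (to_ninfty g x))%R -> escapes g.
Proof.
move=> gh px y; have := prob_ge0 (to_pinfty g x).
rewrite le_eqVlt => /orP[/eqP p0|p0]; last exact: prob_to_infty_eq1 gh p0.
move: px; rewrite -p0 add0r to_ninfty_conj => /(prob_to_infty_eq1 (- y)).
move=> /(_ _ (shiftable_pair_conj gh)).
by rewrite [to_pinfty g y]to_pinfty_conj [to_ninfty g y]to_ninfty_conj addrC.
Qed.

(** A zero-one law: escape is shift-stable, and the constant value of its probability is itself a
    uniform bound below 1. *)
Lemma to_pinfty_constant_null g h : shiftable_pair g h ->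
  (forall x y, prob (to_pinfty g x) = prob (to_pinfty g y)) ->
  (prob (to_pinfty g 0) < 1)%R -> forall x, prob (to_pinfty g x) = 0%R.
Proof.
move=> gh cst lt1 x; have mup := measurable_to_pinfty g.
rewrite /prob (@shift_stable_null g (to_pinfty g) (prob (to_pinfty g 0)))//.
- by move=> n u z /(to_pinfty_shift g n u z).1.
- by rewrite prob_ge0.
- by move=> z; rewrite probE// (cst z 0%R).
Qed.

(** Without oscillation the system escapes almost surely, so phi_- = 1 - phi_+. A constant phi_+ is
    0 or 1; otherwise both functions are nonconstant. *)
Lemma escape_trichotomy g h : shiftable_pair g h ->
  [\/ escapes_one_way g, oscillates g | escapes_both_ways g].
Proof.
move=> gh.
have [osc|/existsNP[x px]] := pselect (oscillates g); first by constructor 2.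
have e : escapes g.
  apply: (escapes_of_gt0 gh (x := x)); rewrite lt_neqAle addr_ge0 ?prob_ge0// andbT.
  apply: contra_notN px => /eqP/esym/eqP.
  by rewrite paddr_eq0 ?prob_ge0// => /andP[/eqP-> /eqP->].
have [cp|/existsNP[y /existsNP[z yz]]] := pselect (forall x y,
  prob (to_pinfty g x) = prob (to_pinfty g y)).
  constructor 1.
  have [lt1|ge1] := ltP (prob (to_pinfty g 0)) 1%R.
    right=> y; have := e y.
    by rewrite (to_pinfty_constant_null gh)// add0r.
  left=> y; apply/eqP; rewrite eq_le (cp y 0%R) ge1 andbT.
  by rewrite -lee_fin -probE ?probability_le1//; exact: measurable_to_pinfty.
constructor 3; split=> //; first by exists y, z.
by exists y, z => nyz; apply: yz; have := e y; have := e z; lra.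
Qed.

Lemma escapes_up_to_ninfty0 g : escapes_up g ->
  forall x, prob (to_ninfty g x) = 0%R.
Proof.
move=> h x; have := prob_to_infty_le1 g x; have := prob_ge0 (to_ninfty g x).
by rewrite h; lra.
Qed.

Lemma escapes_down_to_pinfty0 g : escapes_down g ->
  forall x, prob (to_pinfty g x) = 0%R.
Proof.
move=> h x; have := prob_to_infty_le1 g x; have := prob_ge0 (to_pinfty g x).
by rewrite h; lra.
Qed.

Lemma escapes_one_way_or_both g :
  escapes_one_way g \/ escapes_both_ways g -> escapes g.
Proof.
move=> [[] h|[//]] x.
  by rewrite h (escapes_up_to_ninfty0 h) addr0.
by rewrite h (escapes_down_to_pinfty0 h) add0r.
Qed.

(** The duality bounds for +oo and -oo have left sides adding up to 2, so neither inequality can be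
    strict. *)
Lemma escapes_duality g h x y : shiftable_pair g h -> escapes g -> escapes h ->
  (prob (to_pinfty g x) + prob (to_pinfty h y) = 1)%R.
Proof.
move=> gh eg eh; have := prob_duality x y gh.
have := prob_duality (- x) (- y) (shiftable_pair_conj gh).
by rewrite -!to_ninfty_conj; have := eg x; have := eh y; lra.
Qed.

(** Varying one point in [escapes_duality] shows that both escape probabilities are constant, which
    rules out escape both ways and gives the two systems opposite directions. *)
Lemma escapes_opposite g h : shiftable_pair g h ->
  escapes_one_way g \/ escapes_both_ways g ->
  escapes_one_way h \/ escapes_both_ways h ->
  (escapes_up g /\ escapes_down h) \/ (escapes_down g /\ escapes_up h).
Proof.
move=> gh tg th.
have eg := escapes_one_way_or_both tg; have eh := escapes_one_way_or_both th.
have D x y := escapes_duality x y gh eg eh.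
case: tg => [|[_ [x [y xy]] _]]; last first.
  by case: xy; have := D x 0%R; have := D y 0%R; lra.
move=> [] g1.
  by left; split=> // x; have := eh x; have := D 0%R x; rewrite g1; lra.
by right; split=> // x; have := D 0%R x; rewrite (escapes_down_to_pinfty0 g1) add0r.
Qed.

Lemma one_way_not_oscillates g : escapes_one_way g -> ~ oscillates g.
Proof. by move=> [] h /(_ 0%R)[]; rewrite h => *; lra. Qed.

Lemma one_way_not_both_ways g : escapes_one_way g -> ~ escapes_both_ways g.
Proof.
move=> [] h [_ [x [y xy]] _]; apply: xy; first by rewrite !h.
by rewrite !(escapes_down_to_pinfty0 h).
Qed.

Lemma oscillates_not_both_ways g : oscillates g -> ~ escapes_both_ways g.
Proof. by move=> h [/(_ 0%R) + _ _]; have [-> ->] := h 0%R; lra. Qed.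

(** * The four cases in terms of escape types *)

Lemma phi_plusE g x : phi_plus Q coord g x = (prob (to_pinfty g x))%:E.
Proof. exact: probE (measurable_to_pinfty g x). Qed.

Lemma phi_minusE g x : phi_minus Q coord g x = (prob (to_ninfty g x))%:E.
Proof. exact: probE (measurable_to_ninfty g x). Qed.

Lemma phi_plus_eq1 g : (forall x, phi_plus Q coord g x = 1) <-> escapes_up g.
Proof.
by split=> h x; [have := h x; rewrite phi_plusE => -[]|rewrite phi_plusE h].
Qed.

Lemma phi_minus_eq1 g : (forall x, phi_minus Q coord g x = 1) <-> escapes_down g.
Proof.
by split=> h x; [have := h x; rewrite phi_minusE => -[]|rewrite phi_minusE h].
Qed.

Lemma phi_zero_eq1 g : (forall x, phi_zero Q coord g x = 1) <-> oscillates g.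
Proof.
split=> h x.
  have := h x; rewrite /phi_zero phi_plusE phi_minusE -!EFinB => -[].
  have := prob_ge0 (to_pinfty g x); have := prob_ge0 (to_ninfty g x).
  by move=> *; split; lra.
by rewrite /phi_zero phi_plusE phi_minusE; have [-> ->] := h x; rewrite !sube0.
Qed.

Lemma phi_zero_eq0 g : (forall x, phi_zero Q coord g x = 0) <-> escapes g.
Proof.
split=> h x; have := h x; rewrite /phi_zero phi_plusE phi_minusE -!EFinB.
  by move=> -[]; lra.
by move=> e; congr (_%:E); lra.
Qed.

Lemma phi_nonconstant g :
  [/\ (forall x, phi_zero Q coord g x = 0), nonconstant (phi_plus Q coord g) &
      nonconstant (phi_minus Q coord g)] <-> escapes_both_ways g.
Proof.
split=> -[e [x [y xy]] [z [t zt]]].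
  split; first exact/phi_zero_eq0.
    by exists x, y; apply: contra_not xy; rewrite !phi_plusE => ->.
  by exists z, t; apply: contra_not zt; rewrite !phi_minusE => ->.
split; first exact/phi_zero_eq0.
  by exists x, y; apply: contra_not xy; rewrite !phi_plusE => -[].
by exists z, t; apply: contra_not zt; rewrite !phi_minusE => -[].
Qed.

Lemma case_holdsE k g h : case_holds Q coord k (g, h) <->
  match k with
  | 1 => escapes_up g /\ escapes_down h
  | 2 => escapes_up g /\ oscillates h
  | 3 => oscillates g /\ oscillates h
  | 4 => escapes_both_ways g /\ oscillates h
  | _ => False
  end.
Proof.
case: k => [|[|[|[|[|k]]]]] //=.
- by rewrite phi_plus_eq1 phi_minus_eq1.
- by rewrite phi_plus_eq1 phi_zero_eq1.
- by rewrite !phi_zero_eq1.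
- rewrite phi_zero_eq1 -phi_nonconstant; split; first by move=> [? [? []]].
  by move=> [[]].
Qed.

(* What the four cases say up to interchanging the two systems and up to
   conjugation by [x |-> -x]. *)
Definition case_kind (k : nat) g h : Prop :=
  match k with
  | 1 => escapes_one_way g /\ escapes_one_way h
  | 2 => escapes_one_way g /\ oscillates h
  | 3 => oscillates g /\ oscillates h
  | 4 => escapes_both_ways g /\ oscillates h
  | _ => False
  end.

Lemma case_holds_kind k g h :
  case_holds Q coord k (g, h) -> case_kind k g h.
Proof.
rewrite case_holdsE /case_kind /escapes_one_way.
by case: k => [|[|[|[|[|k]]]]] //= [? ?]; tauto.
Qed.

Lemma case_kind_conj k g h :
  case_kind k (conj_minus g) (conj_minus h) <-> case_kind k g h.
Proof.
rewrite /case_kind.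
by case: k => [|[|[|[|[|k]]]]] //=;
  rewrite ?escapes_one_way_conj ?oscillates_conj ?escapes_both_ways_conj.
Qed.

Lemma case_holds_transform_kind (s c : bool) k g h :
  case_holds Q coord k (transform s c (g, h)) ->
  case_kind k g h \/ case_kind k h g.
Proof.
rewrite /transform; case: c => /=.
  by case: s => /case_holds_kind/case_kind_conj; [right|left].
by case: s => /case_holds_kind; [right|left].
Qed.

(** The three types of [escape_trichotomy] exclude each other, and the number of the case is
    determined by the unordered pair of types of the two systems. *)
Lemma case_kind_unique k k' g h :
  case_kind k g h \/ case_kind k h g ->
  case_kind k' g h \/ case_kind k' h g -> k' = k.
Proof.
have := @one_way_not_oscillates g; have := @one_way_not_oscillates h.
have := @one_way_not_both_ways g; have := @one_way_not_both_ways h.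
have := @oscillates_not_both_ways g; have := @oscillates_not_both_ways h.
rewrite /case_kind.
by case: k => [|[|[|[|[|k]]]]]; case: k' => [|[|[|[|[|k']]]]] //=; tauto.
Qed.

Lemma path_classification g h : shiftable_pair g h -> exists k : nat,
  (exists s c : bool, case_holds Q coord k (transform s c (g, h))) /\
  (forall (s c : bool) (k' : nat),
     case_holds Q coord k' (transform s c (g, h)) -> k' = k).
Proof.
move=> gh.
suff [k [s [c Hk]]] : exists k : nat, exists s c : bool,
    case_holds Q coord k (transform s c (g, h)).
  exists k; split; first by exists s, c.
  move=> s' c' k' Hk'.
  exact: case_kind_unique (case_holds_transform_kind Hk) (case_holds_transform_kind Hk').
have opp := escapes_opposite gh.
have both : (escapes_one_way g \/ escapes_both_ways g) /\
    (escapes_one_way h \/ escapes_both_ways h) -> exists k : nat,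
    exists s c : bool, case_holds Q coord k (transform s c (g, h)).
  move=> [tg th]; exists 1%N, false; case: (opp tg th) => -[g1 h1].
    by exists false; apply/case_holdsE.
  by exists true; apply/case_holdsE; rewrite escapes_up_conj escapes_down_conj.
case: (escape_trichotomy gh) => tg;
  case: (escape_trichotomy (shiftable_pair_sym gh)) => th;
  try by apply: both; split; tauto.
(* In the remaining goals at least one system oscillates. The first boolean puts the oscillating one
   second; the second turns escape down into escape up. *)
- exists 2%N, false; case: tg => tg; [exists false|exists true]; apply/case_holdsE => //.
  by rewrite escapes_up_conj oscillates_conj.
- exists 2%N, true; case: th => th; [exists false|exists true]; apply/case_holdsE => //.
  by rewrite escapes_up_conj oscillates_conj.
- by exists 3%N, false, false; apply/case_holdsE.
- by exists 4%N, true, false; apply/case_holdsE.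
- by exists 4%N, false, false; apply/case_holdsE.
Qed.

End Law.

(** * From random indices to the space of sequences *)

Section Transfer.
Context {R : realType} {I : countType} {d : measure_display}.
Context {Omega : measurableType d} (P : probability Omega R).
Variable X : nat -> Omega -> I.
Hypothesis mX : forall n i, measurable [set w | X n w = i].

(** [Omega] is pointed, so [X 0 point] supplies the distinguished index. *)
Definition trajectory : Omega -> path_space (X 0 point) := fun w k => X k w.

(** It suffices to treat finite-time events; these are countable unions of cylinders, whose
    preimages are intersections of events [X k w = u k]. *)
Lemma measurable_trajectory : measurable_fun setT trajectory.
Proof.
apply: (@measurability _ _ _ (path_space (X 0 point)) setT trajectory
  (@finite_time I) erefl) => _ [T [n nT] <-]; rewrite setTI.
have mc u : measurable (trajectory @^-1` cyl n u).
  rewrite (_ : _ @^-1` _ =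
      \bigcap_(k in [set k | (k < n)%N]) [set w | X k w = u k]).
    by apply: bigcap_measurableType => k _; exact: mX.
  by apply/seteqP; split.
pose B k : set (path_space (X 0 point)) := T `&` code n @^-1` [set k].
rewrite (_ : T = \bigcup_k B k); last first.
  by apply/seteqP; split=> [u Tu|u [k _ []]//]; exists (code n u).
rewrite preimage_bigcup; apply: bigcup_measurable => k _.
have [[u [Tu <-]]|nk] := pselect (exists u, T u /\ code n u = k).
  by rewrite /B setI_code_cyl.
rewrite (_ : B k = set0) ?preimage_set0//.
by apply/seteqP; split=> // u [Tu ku]; apply: nk; exists u.
Qed.

Definition trajectory_law : probability (path_space (X 0 point)) R :=
  distribution P (mfun_Sub (mem_set measurable_trajectory)).

Lemma iterF_trajectory (g : I -> R -> R) n w x :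
  iterF g X n w x = iterF g coord n (trajectory w) x.
Proof. by elim: n => //= n ->. Qed.

(** [trajectory_law] is an image measure, so the probability of an escape event on sequences is that
    of its preimage in [Omega]. *)
Lemma case_holds_trajectory k (gh : (I -> R -> R) * (I -> R -> R)) :
  case_holds P X k gh = case_holds trajectory_law coord k gh.
Proof.
have e (g : I -> R -> R) x w : (fun n => iterF g X n w x) =
    (fun n => iterF g coord n (trajectory w) x).
  by apply/funext => n; exact: iterF_trajectory.
have ep : phi_plus P X = phi_plus trajectory_law coord.
  apply/funext => g; apply/funext => x; congr (P _).
  by apply/funext => w; rewrite /mkset e.
have em : phi_minus P X = phi_minus trajectory_law coord.
  apply/funext => g; apply/funext => x; congr (P _).
  by apply/funext => w; rewrite /mkset e.
by rewrite /case_holds /phi_zero ep em.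
Qed.

End Transfer.

Theorem theorem3 (R : realType) (I : countType)
  (f finv : I -> R -> R) (p : I -> R)
  (d : measure_display) (Omega : measurableType d)
  (P : probability Omega R) (X : nat -> Omega -> I) :
  (* the support maps f_i are orientation-preserving homeomorphisms *)
  (forall i, is_homeo_plus (f i) (finv i)) ->
  (* weights p_i > 0 summing to 1 *)
  (forall i, 0 < p i) ->
  (\esum_(i in [set: I]) (p i)%:E = 1)%E ->
  (* X n = index of the (n+1)-th random map; the X n are i.i.d. with law p *)
  (forall n i, measurable [set w | X n w = i]) ->
  (forall (n : nat) (s : nat -> I),
     P [set w | forall k, (k < n)%N -> X k w = s k] = (\prod_(k < n) p (s k))%:E) ->
  (* shiftability *)
  (forall x : R, exists i j, f j x < x < f i x) ->
  exists k : nat,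
    (exists s c : bool, case_holds P X k (transform s c (f, finv))) /\
    (forall (s c : bool) (k' : nat),
        case_holds P X k' (transform s c (f, finv)) -> k' = k).
Proof.
move=> homeo p_gt0 _ mX law sh.
have pair : shiftable_pair f finv.
  by split=> // i; have [_ [? [? ?]]] := homeo i.
have Q_cyl n s : trajectory_law P mX (cyl n s) = (\prod_(k < n) p (s k))%:E.
  exact: law.
have [k [[s [c Hk]] Hu]] := path_classification p_gt0 Q_cyl pair.
exists k; split; first by exists s, c; rewrite (case_holds_trajectory P mX).
by move=> s' c' k'; rewrite (case_holds_trajectory P mX); exact: Hu.
Qed.
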